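(* Let $A\in \mathcal{C}_2(\mathcal{H})$ and let $0\leq \nu \leq 1$. Then $$\frac{1+|1-2\nu|}{\sqrt{2}}\,w_{(2,\nu)}(A) \leq w_{(2,\nu)}\left(\begin{bmatrix} 0 & \mathfrak{R}_{\nu}(A) \\ \mathfrak{I}_{\nu}(A) & 0 \end{bmatrix}\right) \leq \sqrt{2}\,w_{(2,\nu)}(A).$$
   Context: $\mathcal{H}$ is a complex Hilbert space. For a complex Hilbert space $\mathcal{K}$, $\mathcal{C}_2(\mathcal{K})$ is the Hilbert--Schmidt class, i.e. the bounded linear operators $T$ on $\mathcal{K}$ with $\|T\|_2=\sqrt{\mathrm{tr}(T^*T)}<\infty$. For $0\leq\nu\leq1$ and $T\in\mathcal{C}_2(\mathcal{K})$, define $$w_{(2,\nu)}(T)=\sup_{\theta\in\mathbb{R}}\left\|\nu e^{i\theta}T+(1-\nu)e^{-i\theta}T^*\right\|_2.$$ For a bounded operator $A$ on $\mathcal{H}$, $\mathfrak{R}_{\nu}(A)=\nu A+(1-\nu)A^*$ and $\mathfrak{I}_{\nu}(A)=\nu(-iA)+(1-\nu)(-iA)^*$. The $2\times2$ operator matrix acts on $\mathcal{H}\oplus\mathcal{H}$, and $w_{(2,\nu)}$ of it is taken with $\mathcal{K}=\mathcal{H}\oplus\mathcal{H}$. *)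

(* Defs.v *)
From HB Require Import structures.
From mathcomp Require Import all_boot all_order all_algebra.
From mathcomp Require Import complex.
From mathcomp Require Import all_classical all_reals all_analysis.

Set Implicit Arguments.
Unset Strict Implicit.
Unset Printing Implicit Defensive.

Import Order.TTheory GRing.Theory Num.Theory.
Import numFieldNormedType.Exports.

Local Open Scope classical_set_scope.
Local Open Scope ring_scope.

(* The scalars are R[i] with R : realType. The inner product is linear in its
   first argument, and completeness is the one of completeNormedModType. *)
HB.mixin Record CompleteNormedModule_isHilbert (R : realType) H
    of CompleteNormedModule R[i] H := {
  hdot : H -> H -> R[i] ;
  hdotDl_subproof : forall x y z, hdot (x + y) z = hdot x z + hdot y z ;
  hdotZl_subproof : forall a x y, hdot (a *: x) y = a * hdot x y ;
  hdotC_subproof : forall x y, hdot x y = (hdot y x)^* ;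
  hdotxx_subproof : forall x, hdot x x = `|x| ^+ 2
}.

#[short(type="hilbertType")]
HB.structure Definition Hilbert (R : realType) :=
  {H of CompleteNormedModule R[i] H & CompleteNormedModule_isHilbert R H}.

Section hdot_theory.
Context (R : realType) (H : hilbertType R).
Implicit Types x y z : H.

Lemma hdotDl x y z : hdot (x + y) z = hdot x z + hdot y z.
Proof. exact: hdotDl_subproof. Qed.

Lemma hdotZl a x y : hdot (a *: x) y = a * hdot x y.
Proof. exact: hdotZl_subproof. Qed.

Lemma hdotC x y : hdot x y = (hdot y x)^*.
Proof. exact: hdotC_subproof. Qed.

Lemma hdotxx x : hdot x x = `|x| ^+ 2.
Proof. exact: hdotxx_subproof. Qed.

Let hdot_bilinear :
  bilinear_for ( *%R : GRing.Scale.law _ _ )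
    (Num.conj \; *%R : GRing.Scale.law _ _) (@hdot R H).
Proof.
split => [z a x y|x a y z] /=; first by rewrite hdotDl hdotZl.
by rewrite hdotC hdotDl hdotZl rmorphD rmorphM/= -!hdotC.
Qed.

HB.instance Definition _ := bilinear_isBilinear.Build R[i] H H _ _ _
  (@hdot R H) hdot_bilinear.

Let hdot_hermitian x y : hdot x y = (-1) ^+ false * Num.conj (hdot y x).
Proof. by rewrite expr0 mul1r -hdotC. Qed.

HB.instance Definition _ := isHermitianSesquilinear.Build R[i] H false Num.conj
  (@hdot R H) hdot_hermitian.

Let hdot_gt0 x : x != 0 -> 0 < hdot x x.
Proof. by move=> x0; rewrite hdotxx exprn_gt0// normr_gt0. Qed.

HB.instance Definition _ := isDotProduct.Build R[i] H (@hdot R H) hdot_gt0.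

End hdot_theory.

(* The product normed module H1 * H2 carries the max norm, hence the alias. *)
Definition hsum (R : realType) (H1 H2 : hilbertType R) : Type := (H1 * H2)%type.

Section hsum_hilbert.
Context (R : realType) (H1 H2 : hilbertType R).
Local Notation V := (hsum H1 H2).
Implicit Types u v : V.

HB.instance Definition _ := GRing.Lmodule.copy V (H1 * H2)%type.

Definition hsum_norm u : R[i] := sqrtC (`|u.1| ^+ 2 + `|u.2| ^+ 2).

Definition hsum_dot u v : R[i] := hdot u.1 v.1 + hdot u.2 v.2.

Let hsum_norm_ge0 u : 0 <= hsum_norm u.
Proof. by rewrite sqrtC_ge0 addr_ge0// exprn_ge0. Qed.

Let hsum_normE u : hsum_norm u = `| `|u.1| + 'i * `|u.2| |.
Proof.
apply/eqP; rewrite -(@eqrXn2 _ 2)// sqrtCK normC2_rect// ?ger0_real//.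
Qed.

Let ler_hsum_normD u v : hsum_norm (u + v) <= hsum_norm u + hsum_norm v.
Proof.
rewrite (hsum_normE u) (hsum_normE v).
apply: (le_trans _ (ler_normD _ _)).
rewrite addrACA -mulrDr -(@ler_pXn2r _ 2)// ?nnegrE ?hsum_norm_ge0//.
rewrite sqrtCK normC2_rect ?realD ?ger0_real//.
by rewrite lerD// ler_pXn2r ?nnegrE ?addr_ge0// ler_normD.
Qed.

Let hsum_normZ (l : R[i]) u : hsum_norm (l *: u) = `|l| * hsum_norm u.
Proof.
rewrite /hsum_norm /= !normrZ !exprMn -mulrDr rootCMl ?exprn_ge0//.
by rewrite exprCK.
Qed.

Let hsum_norm0_eq0 u : hsum_norm u = 0 -> u = 0.
Proof.
move/eqP; rewrite sqrtC_eq0 paddr_eq0 ?exprn_ge0// !sqrf_eq0 !normr_eq0.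
by case: u => a b /= /andP[/eqP -> /eqP ->].
Qed.

HB.instance Definition _ := Lmodule_isNormed.Build R[i] V
  ler_hsum_normD hsum_normZ hsum_norm0_eq0.

Let ler_norm1 u : `|u.1| <= `|u|.
Proof.
rewrite -(@ler_pXn2r _ 2)// ?nnegrE//; rewrite [`|u|]/(hsum_norm u) sqrtCK.
by rewrite lerDl exprn_ge0.
Qed.

Let ler_norm2 u : `|u.2| <= `|u|.
Proof.
rewrite -(@ler_pXn2r _ 2)// ?nnegrE//; rewrite [`|u|]/(hsum_norm u) sqrtCK.
by rewrite lerDr exprn_ge0.
Qed.

Let ler_norm12 u : `|u| <= `|u.1| + `|u.2|.
Proof.
have -> : `|u| = hsum_norm u by [].
rewrite hsum_normE (le_trans (ler_normD _ _))//.
by rewrite normrM normCi mul1r !normr_id.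
Qed.

Let hsum_complete (F : set_system V) : ProperFilter F -> cauchy F -> cvg F.
Proof.
move=> FF /(cauchyP (R := R[i]) F).1 Fc.
have c1 : cvg ((fun u : V => u.1) @ F).
  apply: cauchy_cvg; apply: (cauchy_exP (R := R[i])) => e e0.
  have [x Fx] := Fc e e0; exists x.1.
  suff: F [set u : V | ball x.1 e u.1] by [].
  apply: filterS Fx => u.
  rewrite /= -!ball_normE /ball_ /=.
  exact: le_lt_trans (ler_norm1 (x - u)).
have c2 : cvg ((fun u : V => u.2) @ F).
  apply: cauchy_cvg; apply: (cauchy_exP (R := R[i])) => e e0.
  have [x Fx] := Fc e e0; exists x.2.
  suff: F [set u : V | ball x.2 e u.2] by [].
  apply: filterS Fx => u.
  rewrite /= -!ball_normE /ball_ /=.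
  exact: le_lt_trans (ler_norm2 (x - u)).
apply/cvg_ex.
exists ((lim ((fun u : V => u.1) @ F), lim ((fun u : V => u.2) @ F)) : V).
apply/cvgrPdist_lt => e e0.
have e20 : 0 < e / 2 by rewrite divr_gt0.
near=> u.
apply: (le_lt_trans (ler_norm12 _)); rewrite [e]splitr ltrD//=.
  by near: u; move/cvgrPdist_lt : c1; exact.
by near: u; move/cvgrPdist_lt : c2; exact.
Unshelve. all: by end_near. Qed.

HB.instance Definition _ := Uniform_isComplete.Build V hsum_complete.

Let hsum_dotDl u v w : hsum_dot (u + v) w = hsum_dot u w + hsum_dot v w.
Proof. by rewrite /hsum_dot /= !hdotDl addrACA. Qed.

Let hsum_dotZl a u v : hsum_dot (a *: u) v = a * hsum_dot u v.
Proof. by rewrite /hsum_dot /= !hdotZl mulrDr. Qed.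

Let hsum_dotC u v : hsum_dot u v = (hsum_dot v u)^*.
Proof. by rewrite /hsum_dot rmorphD/= -!hdotC. Qed.

Let hsum_dotxx u : hsum_dot u u = `|u| ^+ 2.
Proof. by rewrite /hsum_dot !hdotxx [RHS]sqrtCK. Qed.

HB.instance Definition _ := CompleteNormedModule_isHilbert.Build R V
  hsum_dotDl hsum_dotZl hsum_dotC hsum_dotxx.

End hsum_hilbert.

Section operators.
Context (R : realType).
Implicit Types (H K : hilbertType R) (nu theta : R).

Definition bounded_operator H K (T : H -> K) : Prop :=
  linear T /\ exists M : R, forall x, `|T x| <= M%:C%C * `|x|.

(* On bounded operators this is the usual adjoint: by the Riesz representation
   theorem and the definiteness of hdot, the set below is then a singleton. *)
Definition adjoint H K (T : H -> K) : K -> H :=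
  xget (0 : K -> H) [set S | forall x y, hdot (T x) y = hdot x (S y)].

Definition orthonormal_set H (B : set H) : Prop :=
  forall e f, B e -> B f -> hdot e f = (e == f)%:R.

(* Orthonormal bases are the maximal orthonormal sets. *)
Definition hilbert_basis H (B : set H) : Prop :=
  orthonormal_set B /\
  forall x, (forall e, B e -> hdot x e = 0) -> x = 0.

(* A basis exists by Zorn's lemma, so set0 is never used as a default. *)
Definition chosen_basis H : set H := xget set0 [set B : set H | hilbert_basis B].

(* Trace of a positive bounded operator, in [0, +oo]: the diagonal entries are
   nonnegative reals and the sum does not depend on the basis. *)
Definition pos_trace H (S : H -> H) : \bar R :=
  \esum_(e in @chosen_basis H) (complex.Re (hdot (S e) e))%:E.

Definition hs_norm H (T : H -> H) : \bar R :=
  sqrte (pos_trace (adjoint T \o T)).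

Definition hilbert_schmidt H (T : H -> H) : Prop :=
  bounded_operator T /\ (hs_norm T < +oo)%E.

Definition expi theta : R[i] := (cos theta +i* sin theta)%C.

(* [w_(2,nu)] with values in \bar R; finite on Hilbert-Schmidt operators. *)
Definition w2 nu H (T : H -> H) : \bar R :=
  ereal_sup [set hs_norm ((nu%:C%C * expi theta) *: T
                + ((1 - nu)%:C%C * expi (- theta)) *: adjoint T)
            | theta in [set: R]].

Definition Re_op nu H (A : H -> H) : H -> H :=
  nu%:C%C *: A + (1 - nu)%:C%C *: adjoint A.

Definition Im_op nu H (A : H -> H) : H -> H :=
  nu%:C%C *: (- 'i *: A) + (1 - nu)%:C%C *: adjoint (- 'i *: A).

Definition op_mx H K (A : H -> H) (B : K -> H) (C : H -> K) (D : K -> K) :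
    hsum H K -> hsum H K :=
  fun u => (A u.1 + B u.2, C u.1 + D u.2).

End operators.

(* Main.v *)
Require Import Defs.
From mathcomp Require Import all_boot all_order all_algebra.
From mathcomp Require Import finmap complex ring lra.
From mathcomp Require Import all_classical all_reals all_analysis.
From mathcomp Require summability.
Import Order.TTheory GRing.Theory Num.Theory.
Import numFieldNormedType.Exports.
Local Open Scope classical_set_scope.
Local Open Scope ring_scope.
Set Implicit Arguments.
Unset Strict Implicit.
Unset Printing Implicit Defensive.
Import summability(totally, totally_filter).
#[local] Existing Instance totally_filter.

(** Write A* for the adjoint of A, S for the square of the Hilbert-Schmidt norm
    of A, z = tr (A^2), a = nu^2 + (1 - nu)^2 and b = 2 nu (1 - nu). Everything
    follows from the expansion of the quadratic form
      || p A + r A* ||_2^2 = (|p|^2 + |r|^2) S + 2 Re (p conj(r) z)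
    ([hs2_pencil]). With p = nu e^(it) and r = (1 - nu) e^(-it) it reads
    a S + b Re (e^(2it) z), and t can be chosen to turn z into |z|, so that
      w(A)^2 = a S + b |z|                              ([w2_pencil]).
    The block operator M with off-diagonal entries the generalized real and
    imaginary parts P and Q of A has || M ||_2^2 = 2 a S and
    tr (M^2) = 2 tr (P Q), where tr (P Q) = a Im z - i (2 nu - 1) Re z; hence
      w(M)^2 = 2 a^2 S + 2 b |tr (P Q)|                 ([w2_block]).
    As |2 nu - 1| |z| <= |tr (P Q)| <= a |z|, the upper bound is
    w(M)^2 <= 2 a w(A)^2 with a <= 1. For the lower bound put d = |1 - 2 nu|,
    so that a = (1 + d^2) / 2 and b = (1 - d^2) / 2: the difference
    2 a^2 S + 2 b d |z| - (1 + d)^2 / 2 (a S + b |z|) is exactly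
    (1 - d)^2 / 2 (a S - b |z|), nonnegative because b <= a and |z| <= S, the
    latter since the quadratic form above is nonnegative.

    The analytic input is that the norm depends neither on the orthonormal basis
    nor on taking adjoints. Both are the single identity [hs2_swap], which is
    Parseval's identity and an exchange of two nonnegative sums; Parseval and
    the existence of adjoints come from the Riesz-Fischer theorem. Traces never
    have to be defined: tr (A^2) enters only as the cross term of the quadratic
    form, and the sum over a basis of the direct sum is handled by swapping each
    entry of the block with its adjoint. *)

(** * Squared moduli and squared norms as real numbers *)

(** The norm and the inner product take values in R[i]; the real-valued squares
    [sqn] and [sqc] keep every estimate in an ordered field. *)
Definition sqn (R : realType) (H : hilbertType R) (x : H) : R :=
  complex.Re (hdot x x).

Definition sqc (R : realType) (c : R[i]) : R :=
  complex.Re c ^+ 2 + complex.Im c ^+ 2.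

Section complex_scalars.
Variable R : realType.
Implicit Types c d : R[i].

Lemma sqc_ge0 c : 0 <= sqc c.
Proof. by rewrite addr_ge0 ?sqr_ge0. Qed.

Lemma mulcJ c : c * c^* = (sqc c)%:C%C.
Proof. by rewrite -normCK -add_Re2_Im2. Qed.

Lemma sqc_conj c : sqc c^* = sqc c.
Proof. by case: c => a b; rewrite /sqc /= sqrrN. Qed.

Lemma sqc_real (r : R) : sqc r%:C%C = r ^+ 2.
Proof. by rewrite /sqc /= expr0n addr0. Qed.

Lemma sqcM c d : sqc (c * d) = sqc c * sqc d.
Proof. by case: c d => a b [a' b']; rewrite /sqc /=; ring. Qed.

Lemma sqc_eq0 c : sqc c = 0 -> c = 0.
Proof.
case: c => a b; rewrite /sqc/= => /eqP.
by rewrite paddr_eq0 ?sqr_ge0// !sqrf_eq0 => /andP[/eqP -> /eqP ->].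
Qed.

Lemma sqc1 : sqc (1 : R[i]) = 1.
Proof. by rewrite (sqc_real (1 : R)) expr1n. Qed.

Lemma conj_realC (r : R) : (r%:C%C : R[i])^* = r%:C%C.
Proof. exact: conjc_real. Qed.

Lemma sqc_small c : (forall e, 0 < e -> sqc c <= e) -> c = 0.
Proof.
move=> h; apply: sqc_eq0; apply/eqP; rewrite eq_le sqc_ge0 andbT.
by apply/ler_addgt0Pr => e e0; rewrite add0r h.
Qed.

End complex_scalars.

(** * Geometry of the inner product *)

Section hilbert_geometry.
Variables (R : realType) (H : hilbertType R).
Implicit Types x y z : H.

Lemma hdotDr x y z : hdot x (y + z) = hdot x y + hdot x z.
Proof. by rewrite linearDr. Qed.

Lemma hdotZr a x y : hdot x (a *: y) = a^* * hdot x y.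
Proof. by rewrite linearZr_LR. Qed.

Lemma hdotBl x y z : hdot (x - y) z = hdot x z - hdot y z.
Proof. by rewrite linearBl. Qed.

Lemma hdotBr x y z : hdot x (y - z) = hdot x y - hdot x z.
Proof. by rewrite linearBr. Qed.

Lemma hdotE x : hdot x x = (sqn x)%:C%C.
Proof. by rewrite /sqn RRe_real// hdotxx realX// normr_real. Qed.

Lemma sqn_norm x : (sqn x)%:C%C = `|x| ^+ 2.
Proof. by rewrite -hdotE hdotxx. Qed.

Lemma sqn_ge0 x : 0 <= sqn x.
Proof. by rewrite -lecR sqn_norm exprn_ge0. Qed.

Lemma sqn_eq0 x : sqn x = 0 -> x = 0.
Proof.
by move=> x0; apply/eqP; rewrite -normr_eq0 -sqrf_eq0 -sqn_norm x0.
Qed.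

Lemma norm_lt_sqn x (e : R[i]) : 0 < e ->
  (`|x| < e) = (sqn x < complex.Re e ^+ 2).
Proof.
move=> e0; rewrite -(@ltr_pXn2r _ 2)// ?nnegrE ?(ltW e0)//.
have -> : e ^+ 2 = (complex.Re e ^+ 2)%:C%C.
  by rewrite rmorphXn /= RRe_real// gtr0_real.
by rewrite -sqn_norm ltcR.
Qed.

Lemma sqnZ a x : sqn (a *: x) = sqc a * sqn x.
Proof.
apply: complexI; rewrite -hdotE hdotZl hdotZr hdotE mulrA mulcJ.
by rewrite rmorphM.
Qed.

Lemma sqnD x y : sqn (x + y) = sqn x + sqn y + 2 * complex.Re (hdot x y).
Proof.
rewrite /sqn hdotDl !hdotDr [hdot y x]hdotC.
by case: (hdot x y) (hdot x x) (hdot y y) => a b [c d] [e f] /=; ring.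
Qed.

Lemma sqnB x y : sqn (x - y) = sqn x + sqn y - 2 * complex.Re (hdot x y).
Proof.
rewrite -scaleN1r sqnD sqnZ hdotZr rmorphN1 mulN1r /sqc /=.
by case: (hdot x y) => a b /=; ring.
Qed.

Lemma sqn_lin a b x y : sqn (a *: x + b *: y) =
  sqc a * sqn x + sqc b * sqn y + 2 * complex.Re (a * b^* * hdot x y).
Proof. by rewrite sqnD !sqnZ hdotZl hdotZr mulrA. Qed.

(** The parallelogram law, with the other diagonal dropped. It makes every
    combination of two square-summable families square-summable. *)
Lemma sqn_lin_le a b x y :
  sqn (a *: x + b *: y) <= 2 * (sqc a * sqn x + sqc b * sqn y).
Proof.
have := sqn_ge0 (a *: x - b *: y); rewrite sqnB sqnD !sqnZ; lra.
Qed.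

(** Expand the squared norm of |y|^2 x - <x, y> y, which is |y|^2 times the
    difference of the two sides. *)
Lemma cauchy_schwarz x y : sqc (hdot x y) <= sqn x * sqn y.
Proof.
have [/sqn_eq0 -> | y0] := eqVneq (sqn y) 0.
  by rewrite linear0r /sqc /= expr0n addr0 mulr_ge0 ?sqn_ge0.
have := sqn_ge0 ((sqn y)%:C%C *: x - hdot x y *: y).
rewrite sqnB !sqnZ hdotZl hdotZr [(_)^* * _]mulrC mulcJ -rmorphM /=.
rewrite sqc_real => h.
have ygt0 : 0 < sqn y by rewrite lt_neqAle eq_sym y0 sqn_ge0.
rewrite -(ler_pM2l ygt0); nra.
Qed.

Lemma hdot_suml (I : Type) (r : seq I) (P : pred I) (F : I -> H) y :
  hdot (\sum_(i <- r | P i) F i) y = \sum_(i <- r | P i) hdot (F i) y.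
Proof.
apply: (big_morph (fun x => hdot x y)); last by rewrite linear0l.
by move=> u v; rewrite hdotDl.
Qed.

Lemma hdot_sumr (I : Type) (r : seq I) (P : pred I) (F : I -> H) y :
  hdot y (\sum_(i <- r | P i) F i) = \sum_(i <- r | P i) hdot y (F i).
Proof.
apply: (big_morph (hdot y)); last by rewrite linear0r.
by move=> u v; rewrite hdotDr.
Qed.

Lemma hdot_inj x y : (forall z, hdot z x = hdot z y) -> x = y.
Proof.
move=> xy; apply/eqP; rewrite -subr_eq0; apply/eqP/sqn_eq0.
by rewrite /sqn hdotBr xy subrr.
Qed.

End hilbert_geometry.

(** * Orthonormal expansions *)

Lemma sum_fsubset (T : choiceType) (V : zmodType) (F : T -> V)
    (I J : {fset T}) (P : pred T) :
  (I `<=` J)%fset ->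
  \sum_(e <- J | P e) F e =
  \sum_(e <- I | P e) F e + \sum_(e <- (J `\` I)%fset | P e) F e.
Proof.
move=> IJ; rewrite (big_fsetIDcond _ (mem I)) /=; congr (_ + _).
  rewrite (_ : [fset x in J | x \in I]%fset = I)//; apply/fsetP => x.
  by rewrite !inE /= andbC; case: (boolP (x \in I)) => // /(fsubsetP IJ).
rewrite (_ : [fset x in J | x \notin I]%fset = (J `\` I)%fset)//.
by apply/fsetP => x; rewrite !inE /= andbC.
Qed.

Section orthonormal_expansions.
Variables (R : realType) (H : hilbertType R) (B : set H).
Hypothesis oB : orthonormal_set B.
Implicit Types (c : H -> R[i]) (J : {fset H}).

(** Partial sums are indexed by all finite sets, so that convergence along
    [totally] makes sense for uncountable orthonormal sets as well. *)
Definition psum c J : H := \sum_(e <- J | e \in B) c e *: e.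

Lemma hdot_psum c J e : B e -> e \in J -> hdot (psum c J) e = c e.
Proof.
move=> Be eJ; rewrite hdot_suml big_mkcond (bigD1_seq e) ?fset_uniq//=.
rewrite mem_set// hdotZl oB// eqxx mulr1 big1 ?addr0// => f fe.
by case: ifPn => // /set_mem Bf; rewrite hdotZl oB// (negbTE fe) mulr0.
Qed.

Lemma sqn_psum c J : sqn (psum c J) = \sum_(e <- J | e \in B) sqc (c e).
Proof.
apply: complexI; rewrite -hdotE {2}/psum hdot_sumr rmorph_sum /=.
rewrite [LHS]big_seq_cond [RHS]big_seq_cond; apply: eq_bigr => e.
move=> /andP[eJ /set_mem Be].
by rewrite hdotZr hdot_psum// mulrC mulcJ.
Qed.

Lemma psum_sub c I J : (I `<=` J)%fset ->
  psum c J - psum c I = psum c (J `\` I)%fset.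
Proof. by move=> IJ; rewrite /psum (sum_fsubset _ _ IJ) addrAC subrr add0r. Qed.

(** Once a finite set I almost exhausts the supremum of the sums of squares, the
    squared distance between the partial sums over I and over any larger set is
    what remains, hence small: the net is Cauchy. *)
Lemma riesz_fischer c (M : R) :
  (forall J, \sum_(e <- J | e \in B) sqc (c e) <= M) ->
  exists y : H, psum c @ totally --> y.
Proof.
move=> cM; apply/cvg_ex; apply: cauchy_cvg; apply: (cauchy_exP (R := R[i])).
move=> e e0.
pose E : set R := range (fun J => \sum_(e <- J | e \in B) sqc (c e)).
have supE : has_sup E.
  split; first by eexists; exists fset0.
  by exists M => _ [J _ <-].
have re0 : 0 < complex.Re e ^+ 2.
  have : 0 < complex.Re e by rewrite -ltcR RRe_real// gtr0_real.
  by move=> ?; rewrite exprn_gt0.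
have [_ [I _ <-] hI] := sup_adherent re0 supE.
exists (psum c I); exists I => // J /= IJ.
rewrite -ball_normE /ball_ /= distrC norm_lt_sqn// psum_sub// sqn_psum.
have : E (\sum_(e <- J | e \in B) sqc (c e)) by exists J.
move/(sup_upper_bound supE); rewrite (sum_fsubset _ _ IJ).
by rewrite ltrBlDr in hI => h; have := le_lt_trans h hI; rewrite ltrD2l.
Qed.

Lemma near_psum c y : psum c @ totally --> y -> forall d : R, 0 < d ->
  \forall J \near totally, sqn (y - psum c J) < d.
Proof.
move=> cy d d0; have d0' : 0 < (Num.sqrt d)%:C%C :> R[i].
  by rewrite ltcR sqrtr_gt0.
move/cvgrPdist_lt : cy => /(_ _ d0'); apply: filterS => J.
by rewrite norm_lt_sqn// sqr_sqrtr// ltW.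
Qed.

(** A partial sum over a set containing e already has coefficient c e, and a unit
    vector e cannot enlarge the distance to the limit. *)
Lemma hdot_riesz_fischer c y e : psum c @ totally --> y -> B e ->
  hdot y e = c e.
Proof.
move=> cy Be; apply/eqP; rewrite -subr_eq0; apply/eqP/sqc_small => d d0.
have /(near_psum cy) [I _ hI] := d0.
have := hI (e |` I)%fset (fsubsetU1 _ _).
move=> /ltW; apply: le_trans.
rewrite -[X in _ - X](@hdot_psum c (e |` I)%fset e) ?fset1U1// -hdotBl.
apply: (le_trans (cauchy_schwarz _ _)).
by rewrite {2}/sqn (oB Be Be) eqxx /= mulr1.
Qed.

Lemma sqn_sub_psum x J : sqn (x - psum (hdot x) J) =
  sqn x - \sum_(e <- J | e \in B) sqc (hdot x e).
Proof.
rewrite sqnB sqn_psum [in X in _ - X]/psum hdot_sumr.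
rewrite (eq_bigr (fun e => (sqc (hdot x e))%:C%C)); last first.
  by move=> e _; rewrite hdotZr mulrC mulcJ.
by rewrite -rmorph_sum /=; ring.
Qed.

Lemma bessel x J : \sum_(e <- J | e \in B) sqc (hdot x e) <= sqn x.
Proof. by rewrite -subr_ge0 -sqn_sub_psum sqn_ge0. Qed.

End orthonormal_expansions.

Section hilbert_bases.
Variables (R : realType) (H : hilbertType R) (B : set H).
Hypothesis hB : hilbert_basis B.

(** The limit given by Riesz-Fischer has the same coefficients as x, and a vector
    orthogonal to a maximal orthonormal set vanishes. *)
Lemma basis_expansion x : psum B (hdot x) @ totally --> x.
Proof.
have [oB cB] := hB.
have [y xy] := riesz_fischer oB (bessel oB x).
suff yx : y = x by move: xy; rewrite yx.
apply/eqP; rewrite eq_sym -subr_eq0; apply/eqP/cB => e Be.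
by rewrite hdotBl (hdot_riesz_fischer oB xy Be) subrr.
Qed.

(** The representing vector is the sum of conj(f e) e over the basis. It exists
    because evaluating f at a finite partial sum, of squared norm s, gives s,
    so that s^2 <= M s. *)
Lemma riesz (f : H -> R[i]) (M : R) : 0 <= M ->
  (forall a x y, f (a *: x + y) = a * f x + f y) ->
  (forall x, sqc (f x) <= M * sqn x) ->
  exists y, forall x, f x = hdot x y.
Proof.
move=> M0 flin fM; have [oB cB] := hB.
have f0 : f 0 = 0 by have := flin (-1) 0 0; rewrite scaler0 addr0 mulN1r addNr.
have fD x y : f (x + y) = f x + f y by rewrite -[x]scale1r flin mul1r scale1r.
have fZ a x : f (a *: x) = a * f x by rewrite -[a *: x]addr0 flin f0 addr0.
have fN x : f (- x) = - f x by rewrite -scaleN1r fZ mulN1r.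
have fpsum c J : f (psum B c J) = \sum_(e <- J | e \in B) c e * f e.
  rewrite /psum (big_morph f fD f0); apply: eq_bigr => e _; exact: fZ.
pose c e := (f e)^*.
have cM (J : {fset H}) : \sum_(e <- J | e \in B) sqc (c e) <= M.
  set s := \sum_(_ <- _ | _) _.
  have fs : f (psum B c J) = s%:C%C.
    rewrite fpsum rmorph_sum; apply: eq_bigr => e _.
    by rewrite mulrC mulcJ sqc_conj.
  have := fM (psum B c J); rewrite fs sqn_psum// sqc_real -/s expr2.
  have [->//|s0] := eqVneq s 0.
  rewrite ler_pM2r// lt_neqAle eq_sym s0 sumr_ge0// => e _; exact: sqc_ge0.
have [y cy] := riesz_fischer oB cM; exists y => x.
have hy e : B e -> f e = hdot e y.
  by move=> Be; rewrite hdotC (hdot_riesz_fischer oB cy Be) conjCK.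
(* Both functionals agree on the partial sums of the expansion of x; K bounds
   the squared modulus of their difference, by |u - v|^2 <= 2 |u|^2 + 2 |v|^2,
   and the added 1 keeps it positive. *)
apply/eqP; rewrite -subr_eq0; apply/eqP/sqc_small => d d0.
pose K := 2 * (M + sqn y) + 1.
have K0 : 0 < K by rewrite ltr_wpDl// mulr_ge0// addr_ge0// sqn_ge0.
have dK : 0 < d / K by rewrite divr_gt0.
have [J _ hJ] := near_psum (@basis_expansion x) dK.
have /ltW := hJ J (fsubset_refl _); rewrite ler_pdivlMr//.
set v := x - _ => hv.
have -> : f x - hdot x y = f v - hdot v y.
  rewrite /v fD fN hdotBl fpsum hdot_suml.
  rewrite [in RHS](eq_bigr (fun e => hdot (hdot x e *: e) y)).
    by ring.
  by move=> e /set_mem Be; rewrite hdotZl hy.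
apply: le_trans hv; have := fM v; have := cauchy_schwarz v y.
have := sqn_ge0 v; rewrite /K /sqc.
case: (f v) (hdot v y) => a b [a' b'] /=.
have := sqr_ge0 (a + a'); have := sqr_ge0 (b + b'); nra.
Qed.

End hilbert_bases.

(** * Existence of orthonormal bases and Parseval's identity *)

Section basis_existence.
Variables (R : realType) (H : hilbertType R).

(** Zorn's lemma on orthonormal sets: a nonzero vector orthogonal to a maximal
    one could be normalized and added to it. *)
Lemma ex_hilbert_basis : exists B : set H, hilbert_basis B.
Proof.
have [F sF tF|B [oB maxB]] := @Zorn_bigcup H (@orthonormal_set R H).
  move=> e f [X FX Xe] [Y FY Yf].
  by have [XY|YX] := tF _ _ FX FY; [apply: (sF Y) => //; exact: XY|
    apply: (sF X) => //; exact: YX].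
exists B; split => // x xB; apply/eqP/negPn/negP => x0.
have nx0 : `|x| != 0 by rewrite normr_eq0.
pose u := `|x|^-1 *: x.
have uu : hdot u u = 1.
  by rewrite hdotxx normrZ normfV normr_id mulVf// expr1n.
have uB e : B e -> hdot u e = 0 by move=> /xB xe; rewrite hdotZl xe mulr0.
have Bu e : B e -> hdot e u = 0 by move=> /uB ue; rewrite hdotC ue conjC0.
have nBu : ~ B u by move=> /uB; rewrite uu => /eqP; rewrite oner_eq0.
apply: (maxB (B `|` [set u])).
  by split=> [e Be|/(_ u) Buu]; [left|apply: nBu; apply: Buu; right].
move=> e f [Be|->] [Bf|->].
- exact: oB.
- by rewrite Bu//; case: eqP Be => // ->.
- by rewrite uB//; case: eqP Bf => // <-.
- by rewrite uu eqxx.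
Qed.

Lemma chosen_basisP : hilbert_basis (@chosen_basis R H).
Proof. exact: xgetPex ex_hilbert_basis. Qed.

End basis_existence.

Section parseval.
Variables (R : realType) (H : hilbertType R) (B : set H).
Hypothesis hB : hilbert_basis B.

(** Bessel's inequality bounds the sum above; the defect of a partial sum is the
    squared distance from x to the partial expansion, which tends to 0. *)
Lemma parseval x : \esum_(e in B) (sqc (hdot x e))%:E = (sqn x)%:E.
Proof.
have [oB _] := hB; apply/eqP; rewrite eq_le; apply/andP; split.
  apply: ge_ereal_sup => _ [X [finX XB] <-].
  rewrite fsbig_finite// sumEFin lee_fin.
  apply: le_trans (bessel oB x (fset_set X)).
  rewrite big_seq_cond [leRHS]big_seq_cond le_eqVlt; apply/orP; left; apply/eqP.
  apply: eq_bigl => e; rewrite andbT in_fset_set// andbC.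
  by case: (boolP (e \in X)) => [/set_mem/XB/mem_set ->|]; rewrite ?andbF.
apply/lee_addgt0Pr => d d0.
have [J _ hJ] := near_psum (basis_expansion hB (x:=x)) d0.
have := hJ J (fsubset_refl _); rewrite sqn_sub_psum// ltrBlDr.
rewrite big_fset_condE/=; set Y := [fset _ | _ in _ & _]%fset.
move=> h; have {}h : ((sqn x)%:E <=
    \sum_(e \in [set` Y]) (sqc (hdot x e))%:E + d%:E)%E.
  by rewrite fsbig_finite// set_fsetK sumEFin -EFinD lee_fin addrC ltW.
apply: (le_trans h); rewrite leeD2r// ereal_sup_ubound//.
exists [set` Y] => //; split => //.
by move=> i/=; rewrite !inE/= => /andP[_]; rewrite inE.
Qed.

End parseval.

(** * Adjoints and the Hilbert-Schmidt norm *)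

(** [adjoint] is a choice among the solutions S of this relation; working with
    the relation gives the adjoints of sums and blocks by exhibiting them. *)
Definition adjoint_pair (R : realType) (H K : hilbertType R)
    (T : H -> K) (S : K -> H) :=
  forall x y, hdot (T x) y = hdot x (S y).

(** The square of [hs_norm], also for operators between two different spaces. *)
Definition hs2 (R : realType) (H K : hilbertType R) (T : H -> K) : \bar R :=
  \esum_(e in @chosen_basis R H) (sqn (T e))%:E.

Section adjoints.
Variable R : realType.
Implicit Types H K : hilbertType R.

Lemma adjoint_pair_sym H K (T : H -> K) S :
  adjoint_pair T S -> adjoint_pair S T.
Proof. by move=> TS x y; rewrite hdotC -TS -hdotC. Qed.

Lemma adjointE H K (T : H -> K) S : adjoint_pair T S -> adjoint T = S.
Proof.
move=> TS; have TA : adjoint_pair T (adjoint T).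
  by apply: (@xgetPex _ 0 [set S | adjoint_pair T S]); exists S.
by apply/funext => y; apply: hdot_inj => x; rewrite -TA TS.
Qed.

Lemma bounded_adjoint H K (T : H -> K) :
  bounded_operator T -> adjoint_pair T (adjoint T).
Proof.
move=> [linT [M TM]].
have TM2 x : sqn (T x) <= M ^+ 2 * sqn x.
  rewrite -lecR rmorphM rmorphXn /= !sqn_norm -exprMn.
  by rewrite ler_pXn2r ?nnegrE// (le_trans _ (TM x)).
have /choice[S TS] : forall y, exists z, forall x, hdot (T x) y = hdot x z.
  move=> y; apply: (@riesz _ _ _ (chosen_basisP H) _ (M ^+ 2 * sqn y)).
  - by rewrite mulr_ge0 ?sqr_ge0 ?sqn_ge0.
  - by move=> a x x'; rewrite linT hdotDl hdotZl.
  - move=> x; apply: (le_trans (cauchy_schwarz _ _)).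
    by rewrite mulrAC ler_wpM2r ?sqn_ge0.
by rewrite (@adjointE _ _ _ S).
Qed.

(** Expand each T e in the basis C and each S f in the basis B: both sides are the
    double sum of |<T e, f>|^2. With T fixed and the bases varying this is
    independence of the basis; it also says that adjoints have equal norms. *)
Lemma hs2_swap H K (T : H -> K) S B C : adjoint_pair T S ->
  hilbert_basis B -> hilbert_basis C ->
  \esum_(e in B) (sqn (T e))%:E = \esum_(f in C) (sqn (S f))%:E.
Proof.
move=> TS hB hC.
rewrite (eq_esum (b := fun e => \esum_(f in C) (sqc (hdot (T e) f))%:E));
  last by move=> e _; rewrite parseval.
rewrite [RHS](eq_esum (b := fun f => \esum_(e in B) (sqc (hdot (S f) e))%:E));
  last by move=> f _; rewrite parseval.
rewrite !(@esum_esum R)//; try by move=> *; rewrite lee_fin sqc_ge0.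
rewrite (reindex_esum (C `*`` (fun=> B)) _ (fun z => (z.2, z.1))); last first.
  split=> //=; first by move=> [i j] [/=].
  by move=> [i1 i2] [j1 j2] /= _ _ [] -> ->.
  by move=> [i1 i2] [Pi1 Qi2] /=; exists (i2, i1).
by apply: eq_esum => -[f e] _ /=; rewrite TS hdotC sqc_conj.
Qed.

Lemma hs2_adj H K (T : H -> K) S : adjoint_pair T S -> hs2 T = hs2 S.
Proof. by move=> TS; apply: hs2_swap => //; exact: chosen_basisP. Qed.

Lemma hs_norm_hs2 H (T S : H -> H) : adjoint_pair T S ->
  hs_norm T = sqrte (hs2 T).
Proof.
move=> TS; rewrite /hs_norm (adjointE TS); congr sqrte; apply: eq_esum => e _.
by rewrite /= (adjoint_pair_sym TS).
Qed.

Lemma adjoint_pair_lin H K (T T' : H -> K) S S' a b :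
  adjoint_pair T S -> adjoint_pair T' S' ->
  adjoint_pair (a *: T + b *: T') (a^* *: S + b^* *: S').
Proof.
move=> TS TS' x y; rewrite !fctE.
by rewrite hdotDl hdotDr !hdotZl !hdotZr !conjCK TS TS'.
Qed.

End adjoints.

(** * Sums of absolutely summable real families *)

Section signed_sums.
Variables (R : realType) (I : choiceType) (D : set I).
Implicit Types f g : I -> R.

(** [esum] is meant for nonnegative families only. A signed sum is recorded as a
    difference of two finite nonnegative ones, a relation that is visibly
    linear. *)
Definition has_sum f (s : R) := exists g h G K,
  [/\ (forall i, D i -> 0 <= g i), (forall i, D i -> 0 <= h i),
      (\esum_(i in D) (g i)%:E = G%:E), (\esum_(i in D) (h i)%:E = K%:E) &
      (forall i, D i -> f i = g i - h i) /\ s = G - K].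

Lemma has_sum_esum f s : has_sum f s -> (forall i, D i -> 0 <= f i) ->
  \esum_(i in D) (f i)%:E = s%:E.
Proof.
move=> [g [h [G [K [g0 h0 gG hK [fE ->]]]]]] f0.
have : (\esum_(i in D) (f i)%:E + K%:E = G%:E)%E.
  rewrite -hK -gG -esumD//.
  by apply: eq_esum => i Di; rewrite -EFinD fE// subrK.
case: esum => //= r [<-].
by rewrite addrK.
Qed.

Lemma esum_has_sum f s : (forall i, D i -> 0 <= f i) ->
  \esum_(i in D) (f i)%:E = s%:E -> has_sum f s.
Proof.
move=> f0 fs; exists f, (fun=> 0), s, 0; split => //.
- by rewrite esum1.
- by rewrite subr0; split=> // i _; rewrite subr0.
Qed.

Lemma has_sumN f s : has_sum f s -> has_sum (fun i => - f i) (- s).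
Proof.
move=> [g [h [G [K [g0 h0 gG hK [fE ->]]]]]].
exists h, g, K, G; split => //; split; last by rewrite opprB.
by move=> i Di; rewrite fE// opprB.
Qed.

Lemma has_sumD f s g t : has_sum f s -> has_sum g t ->
  has_sum (fun i => f i + g i) (s + t).
Proof.
move=> [p [q [P [Q [p0 q0 pP qQ [fE ->]]]]]].
move=> [p' [q' [P' [Q' [p0' q0' pP' qQ' [gE ->]]]]]].
exists (fun i => p i + p' i), (fun i => q i + q' i), (P + P'), (Q + Q').
split.
- by move=> i Di; rewrite addr_ge0 ?p0 ?p0'.
- by move=> i Di; rewrite addr_ge0 ?q0 ?q0'.
- rewrite EFinD -pP -pP' -esumD//.
- rewrite EFinD -qQ -qQ' -esumD//.
- by split=> [i Di|]; rewrite ?fE ?gE//; ring.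
Qed.

Lemma ge0_esumZ f (r : R) : 0 < r -> (forall i, D i -> 0 <= f i) ->
  \esum_(i in D) (r * f i)%:E = (r%:E * \esum_(i in D) (f i)%:E)%E.
Proof.
have le (k : R) u : 0 < k -> (forall i, D i -> 0 <= u i) ->
    (\esum_(i in D) (k * u i)%:E <= k%:E * \esum_(i in D) (u i)%:E)%E.
  move=> k0 u0; apply: ge_ereal_sup => _ [X [finX XD] <-].
  rewrite fsbig_finite//= sumEFin -mulr_sumr EFinM lee_pmul2l//.
  rewrite ereal_sup_ubound//; exists X => //.
  by rewrite fsbig_finite//= sumEFin.
move=> r0 f0; apply/eqP; rewrite eq_le le//=.
rewrite muleC -lee_pdivlMr// muleC.
have := @le r^-1 (fun i => r * f i).
rewrite invr_gt0 => /(_ r0); under eq_esum do rewrite mulKf ?gt_eqF//.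
by apply=> i /f0; apply: mulr_ge0; exact: ltW.
Qed.

Lemma has_sumZ (r : R) f s : has_sum f s -> has_sum (fun i => r * f i) (r * s).
Proof.
have pos (k : R) g t : 0 < k -> has_sum g t ->
    has_sum (fun i => k * g i) (k * t).
  move=> k0 [p [q [P [Q [p0 q0 pP qQ [fE ->]]]]]].
  exists (fun i => k * p i), (fun i => k * q i), (k * P), (k * Q); split.
  - by move=> i /p0; apply: mulr_ge0; exact: ltW.
  - by move=> i /q0; apply: mulr_ge0; exact: ltW.
  - by rewrite ge0_esumZ// pP.
  - by rewrite ge0_esumZ// qQ.
  - by rewrite mulrBr; split=> // i Di; rewrite fE// mulrBr.
have [r0|r0|->] := ltgtP r 0.
- move=> /(pos (- r)); rewrite oppr_gt0 => /(_ r0)/has_sumN.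
  by under eq_fun do rewrite mulNr opprK; rewrite mulNr opprK.
- exact: pos.
- move=> _; under eq_fun do rewrite mul0r; rewrite mul0r.
  by apply: esum_has_sum => //; rewrite esum1.
Qed.

Lemma has_sum_le f g s : (forall i, D i -> 0 <= f i <= g i) ->
  \esum_(i in D) (g i)%:E = s%:E -> exists t, has_sum f t.
Proof.
move=> fg gs; exists (fine (\esum_(i in D) (f i)%:E)).
have f0 i : D i -> 0 <= f i by move=> /fg/andP[].
apply: esum_has_sum => //; rewrite fineK// ge0_fin_numE.
  rewrite (@le_lt_trans _ _ s%:E) ?ltry// -gs; apply: le_esum => i /fg.
  by rewrite lee_fin => /andP[].
by apply: esum_ge0 => i /f0; rewrite lee_fin.
Qed.

End signed_sums.

(** * The quadratic form of the pencil spanned by an operator and its adjoint *)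

Section pencil.
Variables (R : realType) (H : hilbertType R) (A A' : H -> H) (S : R).
Hypothesis AA' : adjoint_pair A A'.
Hypothesis AS : hs2 A = S%:E.

Let B := @chosen_basis R H.

(** The scalar z is the sum of <A e, A' e> over the basis, that is tr (A^2). Its
    real and imaginary parts are summable because, up to multiples of
    |A e|^2 and |A' e|^2, they are squared norms of combinations of A e
    and A' e. *)
Lemma hs2_pencil : exists z : R[i], forall p r : R[i],
  hs2 (p *: A + r *: A') =
  ((sqc p + sqc r) * S + 2 * complex.Re (p * r^* * z))%:E.
Proof.
have A'S : hs2 A' = S%:E by rewrite -(hs2_adj AA').
have sA : has_sum B (fun e => sqn (A e)) S.
  by apply: esum_has_sum => // e _; exact: sqn_ge0.
have sA' : has_sum B (fun e => sqn (A' e)) S.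
  by apply: esum_has_sum => // e _; exact: sqn_ge0.
have sRe c : exists t,
    has_sum B (fun e => complex.Re (c * hdot (A e) (A' e))) t.
  have [t ft] : exists t, has_sum B (fun e => sqn (1 *: A e + c^* *: A' e)) t.
    apply: (@has_sum_le _ _ _ _
      (fun e => 2 * (sqc 1 * sqn (A e) + sqc c^* * sqn (A' e)))
      (2 * (sqc 1 * S + sqc c^* * S))).
      by move=> e _; rewrite sqn_ge0 sqn_lin_le.
    apply: has_sum_esum; last first.
      by move=> e _; rewrite mulr_ge0// addr_ge0// mulr_ge0 ?sqc_ge0 ?sqn_ge0.
    by apply/has_sumZ/has_sumD; apply: has_sumZ.
  exists (2^-1 * (t - (S + sqc c * S))).
  have := has_sumZ 2^-1
    (has_sumD ft (has_sumN (has_sumD sA (has_sumZ (sqc c) sA')))).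
  congr has_sum; apply/funext => e; rewrite sqn_lin conjCK sqc_conj mul1r.
  by rewrite sqc1; field.
have [X sX] := sRe 1; have [Y sY] := sRe (- 'i%C).
(* Re (- i w) = Im w, so Y is the sum of the imaginary parts. *)
exists (X +i* Y)%C => p r.
apply: has_sum_esum; last by move=> e _; exact: sqn_ge0.
have -> : (sqc p + sqc r) * S + 2 * complex.Re (p * r^* * (X +i* Y)%C) =
   (sqc p * S + sqc r * S) +
   (2 * complex.Re (p * r^*) * X + 2 * - complex.Im (p * r^*) * Y).
  by case: (p * r^*) => u v /=; ring.
have := has_sumD (has_sumD (has_sumZ (sqc p) sA) (has_sumZ (sqc r) sA'))
  (has_sumD (has_sumZ (2 * complex.Re (p * r^*)) sX)
            (has_sumZ (2 * - complex.Im (p * r^*)) sY)).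
congr has_sum; apply/funext => e; rewrite !fctE sqn_lin.
by case: (p * r^*) (hdot (A e) (A' e)) => u v [x y] /=; ring.
Qed.

End pencil.

(** * Optimizing over the phase *)

Section phases.
Variable R : realType.
Implicit Types (z : R[i]) (t : R).

(** The phase is minus the argument of z, which [acos] gives up to the sign
    of Im z. *)
Lemma ex_phase z : exists t, complex.Re (expi t * z) = Num.sqrt (sqc z).
Proof.
case: z => x y; rewrite /sqc /expi /=; set Z := Num.sqrt _.
have xy0 : 0 <= x ^+ 2 + y ^+ 2 by rewrite addr_ge0 ?sqr_ge0.
have Z0 : 0 <= Z by exact: sqrtr_ge0.
have ZE : Z ^+ 2 = x ^+ 2 + y ^+ 2 by rewrite sqr_sqrtr.
have [Zz|Zn] := eqVneq Z 0.
  exists 0; rewrite cos0 sin0 Zz.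
  move: ZE; rewrite Zz expr0n /= => /esym/eqP.
  rewrite paddr_eq0 ?sqr_ge0// !sqrf_eq0 => /andP[/eqP -> /eqP ->].
  by rewrite !mulr0 subr0.
have Zp : 0 < Z by rewrite lt_neqAle eq_sym Zn.
have xZ : -1 <= x / Z <= 1.
  by rewrite ler_pdivlMr// ler_pdivrMr//; nra.
have sE : sin (acos (x / Z)) = `|y| / Z.
  rewrite sin_acos// -[RHS]ger0_norm ?divr_ge0// -sqrtr_sqr; congr Num.sqrt.
  rewrite !exprMn exprVn real_normK ?num_real// ZE; field.
  by rewrite -ZE sqrf_eq0.
have cE : cos (acos (x / Z)) = x / Z by rewrite acosK// in_itv.
have key : x / Z * x + y / Z * y = Z.
  by apply: (mulIf Zn); rewrite -expr2 ZE; field.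
have [y0|y0] := leP 0 y.
  exists (- acos (x / Z)); rewrite cosN sinN sE cE ger0_norm// mulNr opprK.
  exact: key.
exists (acos (x / Z)); rewrite sE cE ltr0_norm// mulNr mulNr opprK.
exact: key.
Qed.

Lemma Re_le_sqc z : complex.Re z <= Num.sqrt (sqc z).
Proof.
apply: (le_trans (ler_norm _)); rewrite -sqrtr_sqr.
by rewrite ler_wsqrtr// lerDl sqr_ge0.
Qed.

Lemma sqc_expi t : sqc (expi t) = 1.
Proof. exact: cos2Dsin2. Qed.

Lemma ereal_sup_phase (P Q : R) z : 0 <= Q ->
  ereal_sup [set (Num.sqrt (P + Q * complex.Re (expi (2 * t) * z)))%:E
            | t in [set: R]] = (Num.sqrt (P + Q * Num.sqrt (sqc z)))%:E.
Proof.
move=> Q0; apply/eqP; rewrite eq_le; apply/andP; split.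
  apply: ge_ereal_sup => _ [t _ <-]; rewrite lee_fin ler_wsqrtr// lerD2l.
  rewrite ler_wpM2l// (le_trans (Re_le_sqc _))// sqcM sqc_expi mul1r.
  exact: lexx.
apply: ereal_sup_ubound; have [t tz] := ex_phase z.
by exists (t / 2) => //; rewrite [2 * _]mulrC divfK// tz.
Qed.

End phases.

(** * Off-diagonal block operators *)

Lemma lin_comb (K : comPzRingType) (V : lmodType K) (a b c d e f : K)
    (u v : V) :
  a *: (b *: u + c *: v) + d *: (e *: v + f *: u) =
  (a * b + d * f) *: u + (a * c + d * e) *: v.
Proof.
by rewrite !scalerDr !scalerA !scalerDl [X in _ + X = _]addrC addrACA.
Qed.

Section block.
Variables (R : realType) (H K : hilbertType R).

Lemma adjoint_pair_offdiag (X : K -> H) X' (Y : H -> K) Y' :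
  adjoint_pair X X' -> adjoint_pair Y Y' ->
  adjoint_pair (op_mx 0 X Y 0) (op_mx 0 Y' X' 0).
Proof.
move=> XX YY u v.
change (hdot (0 + X u.2) v.1 + hdot (Y u.1 + 0) v.2 =
  hdot u.1 (0 + Y' v.2) + hdot u.2 (X' v.1 + 0)).
by rewrite !add0r !addr0 XX YY addrC.
Qed.

Lemma offdiag_lin (p r : R[i]) (X X2 : K -> H) (Y Y2 : H -> K) :
  p *: op_mx 0 X Y 0 + r *: op_mx 0 X2 Y2 0 =
  op_mx 0 (p *: X + r *: X2) (p *: Y + r *: Y2) 0.
Proof.
apply/funext => u; congr (_, _) => /=.
  by rewrite !fctE /= !add0r.
by rewrite !fctE /= !addr0.
Qed.

Lemma sqn_hsum (u : hsum H K) : sqn u = sqn u.1 + sqn u.2.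
Proof.
by apply: complexI; rewrite -hdotE rmorphD /= -!hdotE.
Qed.

(** For u in a basis of the direct sum, the block maps u to (X u.2, Y u.1). Each
    of the maps X o snd and Y o fst has as adjoint an adjoint entry followed by
    an inclusion, so swapping twice turns its sum over that basis into a sum
    over a basis of a single summand. *)
Lemma hs2_offdiag (X : K -> H) X' (Y : H -> K) Y' :
  adjoint_pair X X' -> adjoint_pair Y Y' ->
  hs2 (op_mx 0 X Y 0) = (hs2 X + hs2 Y)%E.
Proof.
move=> XX YY.
have pX : adjoint_pair (fun u : hsum H K => X u.2) (fun y => (0, X' y)).
  move=> u y; rewrite XX.
  change (hdot u.2 (X' y) = hdot u.1 0 + hdot u.2 (X' y)).
  by rewrite linear0r add0r.
have pY : adjoint_pair (fun u : hsum H K => Y u.1) (fun y => (Y' y, 0)).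
  move=> u y; rewrite YY.
  change (hdot u.1 (Y' y) = hdot u.1 (Y' y) + hdot u.2 0).
  by rewrite linear0r addr0.
have sqn0 (L : hilbertType R) : sqn (0 : L) = 0 by rewrite /sqn linear0r.
have hX : hs2 (fun u : hsum H K => X u.2) = hs2 X.
  rewrite (hs2_adj pX) (hs2_adj XX); apply: eq_esum => e _.
  by rewrite sqn_hsum /= sqn0 add0r.
have hY : hs2 (fun u : hsum H K => Y u.1) = hs2 Y.
  rewrite (hs2_adj pY) (hs2_adj YY); apply: eq_esum => e _.
  by rewrite sqn_hsum /= sqn0 addr0.
rewrite -hX -hY -esumD; [|by move=> *; rewrite lee_fin sqn_ge0..].
apply: eq_esum => u _; rewrite sqn_hsum EFinD /=.
by congr (_%:E + _%:E)%E; congr sqn; [exact: add0r|exact: addr0].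
Qed.

End block.

(** * The two radii in closed form *)

Section numerical_radius.
Variable R : realType.

(** tr (P Q) for P and Q the generalized real and imaginary parts of an operator
    whose square has trace z: expanding the product, the terms A A* and A* A
    cancel under the trace and -i (nu^2 z - (1 - nu)^2 conj(z)) remains. *)
Definition block_trace (nu : R) (z : R[i]) : R[i] :=
  (((nu ^+ 2 + (1 - nu) ^+ 2) * complex.Im z)
   +i* (- ((2 * nu - 1) * complex.Re z)))%C.

Lemma w2_phase (H : hilbertType R) (T T' : H -> H) (nu P Q : R) z :
  adjoint_pair T T' -> 0 <= Q ->
  (forall t, hs2 ((nu%:C%C * expi t) *: T + ((1 - nu)%:C%C * expi (- t)) *: T')
     = (P + Q * complex.Re (expi (2 * t) * z))%:E) ->
  w2 nu T = (Num.sqrt (P + Q * Num.sqrt (sqc z)))%:E.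
Proof.
move=> TT Q0 hT; rewrite -ereal_sup_phase// /w2; congr ereal_sup.
apply: eq_imagel => t _; rewrite (adjointE TT).
by rewrite (hs_norm_hs2 (adjoint_pair_lin _ _ TT (adjoint_pair_sym TT))) hT.
Qed.

Lemma expi2 (t : R) :
  expi (2 * t) = ((cos t ^+ 2 - sin t ^+ 2) +i* (2 * (cos t * sin t)))%C.
Proof.
rewrite /expi [2 * t]mulrC mulr_natr cos_mulr2n sin_mulr2n mulr_natl.
congr (_ +i* _)%C; rewrite sin2cos2; ring.
Qed.

Section computations.
Variables (H : hilbertType R) (A A' : H -> H) (S nu : R) (z : R[i]).
Hypothesis AA' : adjoint_pair A A'.
Hypothesis nu01 : 0 <= nu <= 1.
Hypothesis pencil : forall p r : R[i],
  hs2 (p *: A + r *: A') =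
  ((sqc p + sqc r) * S + 2 * complex.Re (p * r^* * z))%:E.

Let a := nu ^+ 2 + (1 - nu) ^+ 2.
Let b := 2 * nu * (1 - nu).

Let b0 : 0 <= b.
Proof. by case/andP: nu01 => ? ?; rewrite /b !mulr_ge0// subr_ge0. Qed.

Lemma w2_pencil : w2 nu A = (Num.sqrt (a * S + b * Num.sqrt (sqc z)))%:E.
Proof.
apply: (w2_phase AA') => // t; rewrite pencil expi2; congr _%:E.
rewrite !sqcM !sqc_expi !sqc_real /expi cosN sinN /a /b.
by case: z => x y /=; ring.
Qed.

Lemma w2_block : w2 nu (op_mx 0 (Re_op nu A) (Im_op nu A) 0) =
  (Num.sqrt (2 * a ^+ 2 * S + 2 * b * Num.sqrt (sqc (block_trace nu z))))%:E.
Proof.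
have A'A := adjoint_pair_sym AA'.
have RR : adjoint_pair (Re_op nu A) (nu%:C%C *: A' + (1 - nu)%:C%C *: A).
  have := adjoint_pair_lin nu%:C%C (1 - nu)%:C%C AA' A'A.
  by rewrite /Re_op (adjointE AA') !conj_realC.
have iA : adjoint_pair (- 'i *: A) ('i *: A').
  by move=> x y; rewrite !fctE hdotZl hdotZr AA' conjCi.
have adjiA := adjointE iA.
have II : adjoint_pair (Im_op nu A)
    ((nu%:C%C * 'i) *: A' + ((1 - nu)%:C%C * - 'i) *: A).
  rewrite /Im_op adjiA.
  have := adjoint_pair_lin nu%:C%C (1 - nu)%:C%C iA (adjoint_pair_sym iA).
  by rewrite !conj_realC !scalerA.
have RI := adjoint_pair_offdiag RR II.
apply: (w2_phase RI) => [|t]; first by rewrite mulr_ge0.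
set p := nu%:C%C * _; set r := (1 - nu)%:C%C * _.
rewrite offdiag_lin.
rewrite (hs2_offdiag (adjoint_pair_lin _ _ RR (adjoint_pair_sym II))
  (adjoint_pair_lin _ _ II (adjoint_pair_sym RR))).
rewrite /Re_op /Im_op (adjointE AA') adjiA !scalerA !lin_comb !pencil.
rewrite -EFinD expi2; congr _%:E.
rewrite /p /r -!complexiE /expi cosN sinN /block_trace /sqc /a /b.
have cs := cos2Dsin2 t.
case: z => x y /=.
move: (cos t) (sin t) cs => c s cs.
(* Multiplying by cos^2 + sin^2 makes the identity homogeneous in (c, s). *)
have -> : 2 * (nu ^+ 2 + (1 - nu) ^+ 2) ^+ 2 * S =
  2 * (nu ^+ 2 + (1 - nu) ^+ 2) ^+ 2 * S * (c ^+ 2 + s ^+ 2).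
  by rewrite cs mulr1.
ring.
Qed.

End computations.
End numerical_radius.

(** * Comparison of the closed forms *)

Section scalar_bounds.
Variables (R : realType) (S nu : R) (z : R[i]).
Hypothesis S0 : 0 <= S.
Hypothesis nu01 : 0 <= nu <= 1.

Local Notation a := (nu ^+ 2 + (1 - nu) ^+ 2).
Local Notation b := (2 * nu * (1 - nu)).
Local Notation d := `|1 - 2 * nu|.
Local Notation t := (block_trace nu z).

(** Both bounds on the modulus use a^2 - (2 nu - 1)^2 = (2 nu (1 - nu))^2 >= 0. *)
Lemma block_trace_le : Num.sqrt (sqc t) <= a * Num.sqrt (sqc z).
Proof.
have a0 : 0 <= a by rewrite addr_ge0 ?sqr_ge0.
rewrite -[X in _ <= X * _](ger0_norm a0) -sqrtr_sqr -sqrtrM ?sqr_ge0//.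
rewrite ler_wsqrtr// /block_trace; case: z => x y; rewrite /sqc /=.
have : 0 <= (a ^+ 2 - (2 * nu - 1) ^+ 2) * x ^+ 2.
  apply: mulr_ge0; last exact: sqr_ge0.
  have -> : a ^+ 2 - (2 * nu - 1) ^+ 2 = 4 * (nu * (1 - nu)) ^+ 2 by ring.
  by rewrite mulr_ge0 ?sqr_ge0.
by lra.
Qed.

Lemma block_trace_ge : d * Num.sqrt (sqc z) <= Num.sqrt (sqc t).
Proof.
rewrite -sqrtr_sqr -sqrtrM ?sqr_ge0// ler_wsqrtr//.
rewrite /block_trace; case: z => x y; rewrite /sqc /=.
have : 0 <= (a ^+ 2 - (2 * nu - 1) ^+ 2) * y ^+ 2.
  apply: mulr_ge0; last exact: sqr_ge0.
  have -> : a ^+ 2 - (2 * nu - 1) ^+ 2 = 4 * (nu * (1 - nu)) ^+ 2 by ring.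
  by rewrite mulr_ge0 ?sqr_ge0.
by lra.
Qed.

Lemma upper_bound :
  Num.sqrt (2 * a ^+ 2 * S + 2 * b * Num.sqrt (sqc t)) <=
  Num.sqrt 2 * Num.sqrt (a * S + b * Num.sqrt (sqc z)).
Proof.
rewrite -sqrtrM// ler_wsqrtr//.
have := block_trace_le; have := sqrtr_ge0 (sqc z).
set Z := Num.sqrt (sqc z); set T := Num.sqrt _ => Z0 TZ.
case/andP: nu01 => n0 n1.
have n1' : 0 <= 1 - nu by rewrite subr_ge0.
have b0 : 0 <= b by rewrite !mulr_ge0.
have ab : a = 1 - b by ring.
have : b * T <= b * (a * Z) by rewrite ler_wpM2l.
have : 0 <= b * (a * S) by rewrite !mulr_ge0// addr_ge0// sqr_ge0.
have : 0 <= b * (b * Z) by rewrite !mulr_ge0.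
(* As a + b = 1, the required inequality is a (a S + b |z|) <= a S + b |z|. *)
move: (b) ab b0 => B -> B0; nra.
Qed.

Lemma lower_bound : Num.sqrt (sqc z) <= S ->
  (1 + d) / Num.sqrt 2 * Num.sqrt (a * S + b * Num.sqrt (sqc z)) <=
  Num.sqrt (2 * a ^+ 2 * S + 2 * b * Num.sqrt (sqc t)).
Proof.
have := block_trace_ge; have := sqrtr_ge0 (sqc z).
set Z := Num.sqrt (sqc z); set T := Num.sqrt (sqc _) => Z0 TZ ZS.
case/andP: nu01 => n0 n1.
have n1' : 0 <= 1 - nu by rewrite subr_ge0.
have b0 : 0 <= b by rewrite !mulr_ge0.
have d0 : 0 <= d by [].
have d2 : d ^+ 2 = (1 - 2 * nu) ^+ 2 by rewrite real_normK ?num_real.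
have aE : a = (1 + d ^+ 2) / 2 by rewrite d2; field.
have bE : b = (1 - d ^+ 2) / 2 by rewrite d2; field.
have bT : b * (d * Z) <= b * T by rewrite ler_wpM2l.
have -> : (1 + d) / Num.sqrt 2 = Num.sqrt ((1 + d) ^+ 2 / 2).
  rewrite sqrtrM ?sqr_ge0// sqrtrV// sqrtr_sqr.
  by rewrite (@ger0_norm _ (1 + d)) ?addr_ge0.
rewrite -sqrtrM ?divr_ge0 ?sqr_ge0// ler_wsqrtr//.
have key : 0 <= (1 - d) ^+ 2 / 2 * (a * S - b * Z).
  rewrite mulr_ge0 ?divr_ge0 ?sqr_ge0// subr_ge0.
  apply: (@le_trans _ _ (b * S)); first by rewrite ler_wpM2l.
  by rewrite ler_wpM2r// aE bE ler_pM2r// lerD2l; have := sqr_ge0 d; lra.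
suff : (1 + d) ^+ 2 / 2 * (a * S + b * Z) + (1 - d) ^+ 2 / 2 * (a * S - b * Z)
       = 2 * a ^+ 2 * S + 2 * (b * (d * Z)) by lra.
by rewrite aE; field.
Qed.

End scalar_bounds.

Theorem theorem3p12 (R : realType) (H : hilbertType R) (A : H -> H) (nu : R) :
  hilbert_schmidt A -> 0 <= nu <= 1 ->
  (((1 + `|1 - 2 * nu|) / Num.sqrt 2)%:E * w2 nu A
     <= w2 nu (op_mx 0%R (Re_op nu A) (Im_op nu A) 0%R)
   /\ w2 nu (op_mx 0%R (Re_op nu A) (Im_op nu A) 0%R)
     <= (Num.sqrt 2)%:E * w2 nu A)%E.
Proof.
move=> [bA hsA] nu01; have AA' := bounded_adjoint bA.
have hs0 (T : H -> H) : (0 <= hs2 T)%E.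
  by apply: esum_ge0 => e _; rewrite lee_fin sqn_ge0.
have [S AS] : exists S, hs2 A = S%:E.
  move: hsA (hs0 A); rewrite (hs_norm_hs2 AA').
  by case: hs2 => //= S _ _; exists S.
have S0 : 0 <= S by have := hs0 A; rewrite AS lee_fin.
have [z pencil] := hs2_pencil AA' AS.
have zS : Num.sqrt (sqc z) <= S.
  (* The form at p = e^(it), r = 1, with t chosen so that e^(it) z = - |z|. *)
  have [t tz] := ex_phase (- z).
  have := hs0 (expi t *: A + 1 *: adjoint A).
  rewrite pencil lee_fin sqc_expi sqc1 conjC1 mulr1.
  have -> : sqc z = sqc (- z) by case: (z) => x y; rewrite /sqc /= !sqrrN.
  rewrite -tz mulrN; case: (expi t * z) => x y /=; lra.
rewrite (w2_block AA' nu01 pencil) (w2_pencil AA' nu01 pencil) -!EFinM !lee_fin.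
by split; [exact: lower_bound | exact: upper_bound].
Qed.
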